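(* Let $(p_1, \ldots, p_m)$ be an $m$-tuple of real polynomials in $t \in \mathbf{R}^n$, and let $$\theta(t) = (1 + t_1^2 + \cdots + t_n^2)^{-1}, \quad t \in \mathbf{R}^n.$$ Let $p$ be a real polynomial on $\mathbf{R}^n$. Suppose that the degrees of the $p_j$'s and of $p$ are all even. Let $P_1, \ldots, P_m, P$ be the corresponding homogenizations of the polynomials $p_1, \ldots, p_m, p$, and assume that $P(x) > 0$ whenever $x \in \bigcap_{k=1}^m P_k^{-1}(\mathbf{R}_+)$, $x \neq 0$. Then there exist an integer $b \geq 0$ and a finite collection of real polynomials $\{q_\ell, q_{k\ell}\}$, $\ell \in L$, $k = 1, \ldots, m$, such that $$p(t) = \theta(t)^{2b}\left(\sum_{\ell \in L} q_\ell(t)^2 + \sum_{k=1}^m \sum_{\ell \in L} p_k(t) q_{k\ell}(t)^2\right), \quad t \in \mathbf{R}^n.$$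
   Context: $n \ge 1$ is a fixed integer; $\mathbf{R}_+ = [0,\infty)$. The homogenization of a polynomial $p$ in $t \in \mathbf{R}^n$ with $\deg(p) = d$ is the homogeneous polynomial $P$ of degree $d$ in $x = (x_0, x_1, \ldots, x_n) \in \mathbf{R}^{n+1}$ determined by $P(x_0, x_1, \ldots, x_n) = x_0^d\, p\!\left(\frac{x_1}{x_0}, \ldots, \frac{x_n}{x_0}\right)$ for $x_0 \neq 0$. *)

(* Defs.v *)
From HB Require Import structures.
From mathcomp Require Import all_boot all_order all_algebra.
From mathcomp Require Import mpoly.
From mathcomp Require Import reals.

Set Implicit Arguments.
Unset Strict Implicit.
Unset Printing Implicit Defensive.

Import Order.TTheory GRing.Theory Num.Theory.
Local Open Scope ring_scope.

(* [msize p] is the total degree plus one, and [msize 0 = 0]; hence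
   [mpoly_deg 0 = 0], so that the zero polynomial counts as having even
   degree. *)
Definition mpoly_deg (R : realType) (n : nat) (p : {mpoly R[n]}) : nat :=
  (msize p).-1.

(* [x 0 0] is the homogenizing coordinate x_0 and [x 0 (lift ord0 i)], for
   [i < n], is x_{i+1}.  [P] is homogeneous of degree exactly [mpoly_deg p], or
   zero. *)
Definition is_homogenization (R : realType) (n : nat)
    (p : {mpoly R[n]}) (P : {mpoly R[n.+1]}) : Prop :=
  P \is (mpoly_deg p).-homog /\
  forall x : 'rV[R]_n.+1, x 0 0 != 0 ->
    P.@[x 0] =
    x 0 0 ^+ mpoly_deg p * p.@[fun i : 'I_n => x 0 (lift ord0 i) / x 0 0].

Definition theta (R : realType) (n : nat) (t : 'rV[R]_n) : R :=
  (1 + \sum_(i < n) t 0 i ^+ 2)^-1.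

Definition homog_mnm (n d : nat) (m : 'X_{1.. n}) : 'X_{1.. n.+1} :=
  [multinom oapp m (d - mdeg m)%N (unlift ord0 i) | i < n.+1].

Lemma homogenization_exists (R : realType) (n : nat) (p : {mpoly R[n]}) :
  exists P : {mpoly R[n.+1]}, is_homogenization p P.
Proof.
set d := mpoly_deg p.
have led m : m \in msupp p -> (mdeg m <= d)%N.
  move=> /msize_mdeg_lt; rewrite /d /mpoly_deg.
  by case: (msize p).
have h0 m : homog_mnm d m ord0 = (d - mdeg m)%N.
  by rewrite mnmE unlift_none.
have hS m i : homog_mnm d m (lift ord0 i) = m i by rewrite mnmE liftK.
exists (\sum_(m <- msupp p) p@_m *: 'X_[homog_mnm d m]); split.
  rewrite big_seq; apply: rpred_sum => m /led lem.
  apply: rpredZ; rewrite dhomogX; apply/eqP.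
  rewrite /= mdegE big_ord_recl h0.
  under eq_bigr do rewrite hS.
  by rewrite -mdegE subnK.
move=> x x0; rewrite -/d [in RHS]mevalE raddf_sum mulr_sumr /=.
rewrite big_seq [RHS]big_seq; apply: eq_bigr => m /led lem.
rewrite mevalZ mevalX big_ord_recl h0 [RHS]mulrCA.
congr (_ * _).
rewrite (eq_bigr (fun i => x 0 (lift ord0 i) ^+ m i)) => [|i _]; last first.
  by rewrite hS.
rewrite [in RHS](eq_bigr _ (fun i _ => expr_div_n _ _ _)).
rewrite prodf_div prodrXr -mdegE.
have -> : x 0 0 ^+ d = x 0 0 ^+ (d - mdeg m) * x 0 0 ^+ mdeg m.
  by rewrite -exprD subnK.
by rewrite -mulrA [X in _ = _ * X]mulrC divfK // expf_neq0.
Qed.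

Lemma meval_eq0 (R : realType) (n : nat) (p : {mpoly R[n]}) :
  (forall v : 'I_n -> R, p.@[v] = 0) -> p = 0.
Proof.
elim: n p => [|n IHn] p p0.
  have pE : p = (p@_0)%:MP.
    apply/mpolyP => m; rewrite mcoeffC.
    have -> : m = 0%MM by apply/mnmP => -[].
    by rewrite eqxx mulr1.
  have c0 : p@_0 = 0 by rewrite -(p0 (fun=> 0)) {2}pE mevalC.
  by rewrite pE c0 mpolyC0.
have pV v a : (map_poly (meval v) (muni p)).[a] =
    p.@[fun i => oapp v a (unlift ord_max i)].
  have wE i : widen_ord (leqnSn n) i = lift ord_max i.
    by apply/val_inj; rewrite /= /bump leqNgt ltn_ord.
  rewrite muniE mevalE raddf_sum horner_sum; apply: eq_bigr => m _.
  rewrite /= map_polyZ map_polyXn hornerZ hornerXn /= mevalZ mevalX big_ord_recr /=.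
  rewrite unlift_none mulrA; congr (_ * _ * _); apply: eq_bigr => i _.
  by rewrite mnmE wE liftK.
have mu0 : muni p = 0.
  apply/polyP => k; rewrite coef0; apply: IHn => v.
  rewrite -coef_map /=.
  have -> : map_poly (meval v) (muni p) = 0; last by rewrite coef0.
  apply/eqP/negPn/negP => q0.
  set q := map_poly _ _ in q0.
  pose rs := [seq i%:R : R | i <- iota 0 (size q)].
  have rs_root : all (root q) rs by apply/allP => a _; rewrite /root pV p0.
  have rs_uniq : uniq rs.
    by rewrite map_inj_uniq ?iota_uniq //; apply: (mulrIn (oner_neq0 R)).
  by have := max_poly_roots q0 rs_root rs_uniq; rewrite size_map size_iota ltnn.
have <- : (map_poly (@mwiden n R) (muni p)).['X_ord_max] = p.
  rewrite [RHS]mpolyE muniE raddf_sum horner_sum; apply: eq_bigr => m _.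
  rewrite /= map_polyZ map_polyXn hornerZ hornerXn /= mwidenZ mwidenX.
  rewrite -scalerAl; congr (_ *: _).
  rewrite mpolyXn -mpolyXD; congr 'X_[_]; apply/mnmP => i.
  rewrite mnmDE mulmnE mnm1E; case: (unliftP ord_max i) => [j|] ->.
    have -> : lift ord_max j = widen_ord (leqnSn n) j.
      by apply/val_inj; rewrite /= /bump leqNgt ltn_ord.
    rewrite mnmwiden_widen mnmE -val_eqE /= gtn_eqF ?ltn_ord //.
    by rewrite mul0n addn0.
  by rewrite mnmwiden_ordmax eqxx mul1n.
by rewrite mu0 map_poly0 horner0.
Qed.

Lemma homogenization_unique (R : realType) (n : nat) (p : {mpoly R[n]})
    (P Q : {mpoly R[n.+1]}) :
  is_homogenization p P -> is_homogenization p Q -> P = Q.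
Proof.
move=> [_ hP] [_ hQ]; apply/eqP; rewrite -subr_eq0.
have : 'X_ord0 * (P - Q) = 0.
  apply: meval_eq0 => v; rewrite mevalM mevalXU mevalB.
  have [->|v0] := eqVneq (v ord0) 0; first by rewrite mul0r.
  have vE : v =1 (\row_i v i) 0 by move=> i; rewrite mxE.
  by rewrite !(meval_eq _ vE) hP ?hQ ?mxE // subrr mulr0.
move/eqP; rewrite mulf_eq0 => /orP[/eqP X0|//].
have := mevalXU (fun=> 1 : R) (@ord0 n).
by rewrite X0 meval0 => /esym/eqP; rewrite oner_eq0.
Qed.

(* Main.v *)
Require Import Defs.
From HB Require Import structures.
From mathcomp Require Import all_boot all_order all_algebra.
From mathcomp Require Import ring lra zify.
From mathcomp Require Import reals.
From mathcomp Require boolp classical_sets filter topology normedtype.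

(* On the unit sphere S, normalize the forms P_k so that P_k <= 1. By compactness
   P + C \sum_k (|P_k| - P_k) is bounded below on S by a positive constant for
   some C, and since (1 - y)^(2e) y <= 1/(2e+1) - (|y| - y)/2 for y <= 1, the
   function P - c \sum_k (1 - P_k)^(2e) P_k is positive on S for suitable c, e.
   Homogenizing with powers of |x|^2 (all degrees are even) gives a form F > 0.

   A positive form F of degree 2D becomes a sum of squares after multiplication
   by a power of |x|^2: F is a form G of degree D in the products x_i x_j, hence
   in the squares z of the linear forms x_i + x_j and x_i - x_j. Adding to G a
   large multiple of a sum of squares of forms vanishing on the image of x |-> z,
   one gets a form positive on the simplex, and by Polya's theorem its product
   with a power of \sum z = |x|^2 has nonnegative coefficients.

   Setting x = (1, t), where |x|^2 = theta(t)^-1, gives the representation. *)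

Set Implicit Arguments.
Unset Strict Implicit.
Unset Printing Implicit Defensive.

Import Order.TTheory GRing.Theory Num.Theory.
Local Open Scope ring_scope.

(** * Continuous functions on the unit sphere and compactness *)

Module SphereCompactness.
Import boolp classical_sets filter topology normedtype.
Import numFieldNormedType.Exports.
Local Open Scope classical_set_scope.

Definition cts (R : realType) (k : nat) (f : 'rV[R]_k -> R) : Prop :=
  forall x : 'rV[R]_k, f @ nbhs (x : ('rV[R]_k : topologicalType)) --> f x.

Section Cts.
Variables (R : realType) (k : nat).
Implicit Types f g : 'rV[R]_k -> R.

Lemma cts_ext f g : cts f -> f =1 g -> cts g.
Proof. by move=> cf /funext <-. Qed.

Lemma cts_cst (c : R) : @cts R k (fun=> c).
Proof. by move=> x; apply: cvg_cst. Qed.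

Lemma cts_coord (i : 'I_k) : @cts R k (fun x => x 0 i).
Proof. move=> x; exact: coord_continuous. Qed.

Lemma ctsD f g : cts f -> cts g -> cts (fun x => f x + g x).
Proof. by move=> cf cg x; apply: cvgD; [apply: cf|apply: cg]. Qed.

Lemma ctsN f : cts f -> cts (fun x => - f x).
Proof. by move=> cf x; apply: cvgN; apply: cf. Qed.

Lemma ctsM f g : cts f -> cts g -> cts (fun x => f x * g x).
Proof. by move=> cf cg x; apply: cvgM; [apply: cf|apply: cg]. Qed.

Lemma cts_norm f : cts f -> cts (fun x => `|f x|).
Proof. by move=> cf x; apply: cvg_norm; apply: cf. Qed.

Lemma cts_sum (I : Type) (r : seq I) (F : I -> 'rV[R]_k -> R) :
  (forall i, cts (F i)) -> cts (fun x => \sum_(i <- r) F i x).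
Proof.
move=> cF; elim: r => [|i r IH].
  by move=> x; under eq_fun do rewrite big_nil; rewrite big_nil; apply: cts_cst.
move=> x; under eq_fun do rewrite big_cons; rewrite big_cons.
exact: ctsD.
Qed.

Lemma cts_prod (I : Type) (r : seq I) (F : I -> 'rV[R]_k -> R) :
  (forall i, cts (F i)) -> cts (fun x => \prod_(i <- r) F i x).
Proof.
move=> cF; elim: r => [|i r IH].
  by move=> x; under eq_fun do rewrite big_nil; rewrite big_nil; apply: cts_cst.
move=> x; under eq_fun do rewrite big_cons; rewrite big_cons.
exact: ctsM.
Qed.

Lemma ctsX f n : cts f -> cts (fun x => f x ^+ n).
Proof.
move=> cf; elim: n => [|n IH]; first exact: cts_cst.
by move=> x; under eq_fun do rewrite exprS; rewrite exprS; apply: ctsM.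
Qed.

Lemma cts_near f (x : 'rV[R]_k) (e : R) : cts f -> 0 < e ->
  \forall y \near (x : ('rV[R]_k : topologicalType)), f x - e < f y.
Proof.
move=> cf e0; have /cvgr_dist_lt/(_ e e0) := cf x.
by apply: filterS => y; rewrite ltr_distlC => /andP[].
Qed.

Lemma compact_sphere : compact [set x : 'rV[R]_k | \sum_i x 0 i ^+ 2 = 1].
Proof.
apply: bounded_closed_compact.
  exists 1; split; first exact: num_real.
  move=> M M1 x /= xS; apply: le_trans (ltW M1).
  rewrite [`|x|]mx_normrE.
  apply: bigmax_le => // -[i j] _ /=; rewrite (ord1 i).
  rewrite -[leRHS]normr1 -ler_sqr ?nnegrE // !real_normK ?num_real // expr1n -xS.
  by rewrite (bigD1 j) //= lerDl; apply: sumr_ge0 => *; exact: sqr_ge0.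
have -> : [set x : 'rV[R]_k | \sum_i x 0 i ^+ 2 = 1] =
    (fun x : 'rV[R]_k => \sum_i x 0 i ^+ 2) @^-1` [set 1] by [].
apply: preimage_closed; last exact: closed_eq.
move=> x _; apply: (@cts_sum _ _ (fun i x => x 0 i ^+ 2)) => i.
exact/ctsX/cts_coord.
Qed.

(* Compactness is used through the near-covering property: for each point [x]
   of the sphere, [f + N g >= 1 / N] holds near [x] for all large [N]. *)
Lemma sphere_penalty f g : cts f -> cts g -> (forall x, 0 <= g x) ->
  (forall x : 'rV[R]_k, \sum_i x 0 i ^+ 2 = 1 -> g x = 0 -> 0 < f x) ->
  exists C c : R, [/\ 0 <= C, 0 < c &
    forall x : 'rV[R]_k, \sum_i x 0 i ^+ 2 = 1 -> c <= f x + C * g x].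
Proof.
move=> cf cg g0 fg.
pose S := [set x : 'rV[R]_k | \sum_i x 0 i ^+ 2 = 1].
suff : \forall n \near \oo, S `<=`
    (fun x => n.+1%:R^-1 <= f x + n.+1%:R * g x).
  case=> n _ /(_ n (leqnn n)) nP.
  by exists n.+1%:R, n.+1%:R^-1; split => //; rewrite invr_gt0.
apply: (iffLR (compact_near_coveringP S) compact_sphere nat \oo
  (fun n x => n.+1%:R^-1 <= f x + n.+1%:R * g x)) => x xS.
have [e [a [e0 a0 ea]]] : exists e a : R, [/\ 0 < e, 0 < a &
    \forall y \near (x : ('rV[R]_k : topologicalType)),
      forall n : nat, e^-1 <= n.+1%:R -> a^-1 <= n.+1%:R ->
      n.+1%:R^-1 <= f y + n.+1%:R * g y].
  have [gx0|gx0] := eqVneq (g x) 0.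
    have fx0 : 0 < f x / 2 by rewrite divr_gt0 // fg.
    exists (f x / 2), 1; split => //.
    apply: filterS (cts_near x cf fx0) => y fy n ne _.
    apply: le_trans (_ : f x / 2 <= _); first by rewrite invf_ple ?posrE.
    apply: le_trans (_ : f y <= _); last by rewrite lerDl mulr_ge0.
    by move: fy; rewrite {1}(splitr (f x)) addrK => /ltW.
  (* Near such an [x], [f > f x - 1] and [g > g x / 2]; once [N * (g x / 2) >= 2 + |f x|], this
     gives [f + N g >= 1 >= 1 / N]. *)
  have gx1 : 0 < g x / 2 by rewrite divr_gt0 // lt_def gx0 g0.
  exists 1, (g x / 2 / (2 + `|f x|)); split => //.
    by rewrite divr_gt0 // ltr_wpDr.
  apply: filterS2 (cts_near x cf ltr01) (cts_near x cg gx1) => y fy gy n _.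
  rewrite invf_div ler_pdivrMr // => nge.
  apply: le_trans (_ : 1 <= _); first by rewrite invf_le1 // ler1n.
  have : n.+1%:R * (g x / 2) <= n.+1%:R * g y.
    by rewrite ler_wpM2l // ltW // (le_lt_trans _ gy) // {2}(splitr (g x)) addrK.
  have := ler_norm (- f x); rewrite normrN; lra.
exists ([set y | forall n : nat, e^-1 <= n.+1%:R -> a^-1 <= n.+1%:R ->
    n.+1%:R^-1 <= f y + n.+1%:R * g y], [set n | e^-1 <= n%:R /\ a^-1 <= n%:R]).
  split => //=; apply: filterI; exact: nbhs_infty_ger.
move=> [y n] /= [yP [en an]]; apply: yP.
  by apply: le_trans en _; rewrite ler_nat.
by apply: le_trans an _; rewrite ler_nat.
Qed.
End Cts.
End SphereCompactness.

(** * Forms as weighted sums of words, and Polya's theorem by counting readings *)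

Section Words.
Variables (R : realType) (T : finType).
Implicit Types (z : T -> R) (F G : (T -> R) -> R).

(* [F] is given by a homogeneous polynomial of degree [d], written as a list of
   coefficients and noncommutative monomials. *)
Definition form d F := exists L : seq (R * d.-tuple T),
  forall z, F z = \sum_(cs <- L) cs.1 * \prod_(t <- cs.2) z t.

Lemma form_ext d F G : form d F -> G =1 F -> form d G.
Proof. by move=> [L FL] GF; exists L => z; rewrite GF. Qed.

Lemma form0 d : form d (fun=> 0).
Proof. by exists [::] => z; rewrite big_nil. Qed.

Lemma form1 : form 0 (fun=> 1).
Proof. by exists [:: (1, [tuple])] => z; rewrite big_seq1 /= big_nil mulr1. Qed.

Lemma form_coord t : form 1 (fun z => z t).
Proof. by exists [:: (1, [tuple t])] => z; rewrite !big_seq1 mul1r. Qed.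

Lemma formD d F G : form d F -> form d G -> form d (fun z => F z + G z).
Proof. by move=> [L FL] [K GK]; exists (L ++ K) => z; rewrite big_cat FL GK. Qed.

Lemma formZ d c F : form d F -> form d (fun z => c * F z).
Proof.
move=> [L FL]; exists [seq (c * cs.1, cs.2) | cs <- L] => z.
by rewrite big_map FL mulr_sumr; apply: eq_bigr => cs _; rewrite mulrA.
Qed.

Lemma formM d e F G : form d F -> form e G -> form (d + e) (fun z => F z * G z).
Proof.
move=> [L FL] [K GK].
exists [seq (a.1 * b.1, cat_tuple a.2 b.2) | a <- L, b <- K] => z.
rewrite big_allpairs_dep FL GK mulr_suml; apply: eq_bigr => a _.
rewrite mulr_sumr; apply: eq_bigr => b _ /=.
by rewrite big_cat /= mulrACA.
Qed.

Lemma formB d F G : form d F -> form d G -> form d (fun z => F z - G z).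
Proof.
move=> hF hG; apply: form_ext (formD hF (formZ (-1) hG)) _ => z.
by rewrite mulN1r.
Qed.

Lemma form_sum d (I : Type) (r : seq I) (F : I -> (T -> R) -> R) :
  (forall i, form d (F i)) -> form d (fun z => \sum_(i <- r) F i z).
Proof.
move=> hF; elim: r => [|i r IH].
  by apply: form_ext (form0 d) _ => z; rewrite big_nil.
by apply: form_ext (formD (hF i) IH) _ => z; rewrite big_cons.
Qed.

Lemma formX d e F : form d F -> form (d * e) (fun z => F z ^+ e).
Proof.
move=> hF; elim: e => [|e IH]; first by rewrite muln0; exact: form1.
rewrite mulnS; apply: form_ext (formM hF IH) _ => z; exact: exprS.
Qed.

Lemma form_homog d F : form d F -> forall a z, F (fun t => a * z t) = a ^+ d * F z.
Proof.
move=> [L FL] a z; rewrite !FL mulr_sumr; apply: eq_bigr => cs _.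
by rewrite big_split /= big_const_seq count_predT size_tuple iter_mulr_1 mulrCA.
Qed.

Variables (d M : nat).

(* [readings s w] is the set of all ways of reading the word [s] off the word
   [w]. Summing over [w], the injective readings produce exactly
   [(\sum_t z t) ^+ (M - d) * \prod_(t <- s) z t]; all readings together evaluate
   the monomial [s] at the letter frequencies of [w]. The two counts differ by
   [O(M ^ (d - 1))], which makes the coefficients in Polya's theorem positive. *)
Definition readings (s : d.-tuple T) (w : {ffun 'I_M -> T}) :
    {set {ffun 'I_d -> 'I_M}} :=
  [set f : {ffun 'I_d -> 'I_M} | [forall j, w (f j) == tnth s j]].

Definition inj_readings (s : d.-tuple T) (w : {ffun 'I_M -> T}) :=
  [set f in readings s w | injectiveb f].

Lemma card_readings s w :
  #|readings s w| = (\prod_(t <- s) #|[set i | w i == t]|)%N.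
Proof.
pose Q j : pred 'I_M := [pred i | w i == tnth s j].
have -> : #|readings s w| = #|family Q|.
  by apply: eq_card => f; rewrite inE; apply/forallP/familyP.
rewrite card_family big_tuple foldrE big_map big_enum /=.
by apply: eq_bigr => j _; rewrite cardsE.
Qed.

Lemma card_readings_inj s w :
  (#|readings s w| <= #|inj_readings s w| + (M ^ d - M ^_ d))%N.
Proof.
pose I := [set f : {ffun 'I_d -> 'I_M} | injectiveb f].
have cI : #|~: I| = (M ^ d - M ^_ d)%N.
  have := cardsC I; rewrite card_ffun !card_ord => <-.
  by rewrite cardsE card_inj_ffuns !card_ord addKn.
rewrite -(cardsID I) -cI leq_add ?subset_leq_card //.
  by apply/subsetP => f; rewrite !inE.
by apply/subsetP => f; rewrite !inE => /andP[].
Qed.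

(** The map [f] fixes the letters of [w] at [d] distinct positions; each of the other [M - d]
    positions is free and contributes a factor [\sum_t z t]. *)
Lemma sum_readings_along s (f : {ffun 'I_d -> 'I_M}) z : injective f ->
  \sum_(w : {ffun 'I_M -> T} | [forall j, w (f j) == tnth s j]) \prod_i z (w i) =
  (\sum_t z t) ^+ (M - d) * \prod_(t <- s) z t.
Proof.
move=> f_inj.
(* [Q i] is the set of letters that [w] may carry at position [i]. *)
pose Q i : pred T := if [pick j | f j == i] is Some j then pred1 (tnth s j) else predT.
have QE (w : {ffun 'I_M -> T}) : [forall j, w (f j) == tnth s j] = (w \in family Q).
  apply/forallP/familyP => [wf i|wf j].
    rewrite /Q; case: pickP => [j /eqP <-|_] //; exact: wf.
  have := wf (f j); rewrite /Q; case: pickP => [j' /eqP /f_inj -> //|/(_ j)].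
  by rewrite eqxx.
rewrite (eq_bigl _ _ QE) -(bigA_distr_big_dep _ (fun=> z)).
rewrite (bigID [pred i | i \in f @: setT]) /= mulrC; congr (_ * _).
  rewrite (eq_bigr (fun=> \sum_t z t)) => [|i fi].
    rewrite prodr_const; congr (_ ^+ _).
    have := cardsC (f @: setT); rewrite card_imset // cardsT !card_ord => cf.
    by rewrite -[RHS](congr1 (subn^~ d) cf) addKn; apply: eq_card => i; rewrite !inE.
  rewrite /Q; case: pickP => [j /eqP fj|_ //].
  by move: fi; rewrite -fj imset_f.
rewrite big_imset /=; last by move=> ? ? _ _; apply: f_inj.
rewrite big_tuple; apply: eq_big => [j|j _]; first by rewrite inE.
rewrite /Q; case: pickP => [j' /eqP /f_inj -> |/(_ j)]; last by rewrite eqxx.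
by rewrite big_pred1_eq.
Qed.

(** After exchanging the sums, each of the [M ^_ d] injective maps contributes the same product. *)
Lemma sum_inj_readings s z :
  \sum_w #|inj_readings s w|%:R * \prod_i z (w i) =
  (M ^_ d)%:R * ((\sum_t z t) ^+ (M - d) * \prod_(t <- s) z t).
Proof.
transitivity (\sum_(f : {ffun 'I_d -> 'I_M} | injectiveb f)
  \sum_(w : {ffun 'I_M -> T} | [forall j, w (f j) == tnth s j]) \prod_i z (w i)).
  rewrite (exchange_big_dep xpredT) //=; apply: eq_bigr => w _.
  rewrite sumr_const -[RHS]mulr_natl; congr (_%:R * _).
  by apply: eq_card => f; rewrite !inE andbC.
rewrite (eq_bigr _ (fun f f_inj => sum_readings_along s z (injectiveP _ f_inj))).
rewrite sumr_const -[LHS]mulr_natl; congr (_%:R * _).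
by rewrite -[in RHS](card_ord M) -[in RHS](card_ord d) -card_inj_ffuns cardsE.
Qed.
End Words.

(** A non-injective map on [d + 1] points is either non-injective on the first [d], or repeats one
    of their [d] values at the last point, which adds at most a fraction [d / M] of all maps; and
    [d ^ 2 + d <= (d + 1) ^ 2]. *)
Lemma ffact_asymp d M : (M * (M ^ d - M ^_ d) <= d ^ 2 * M ^ d)%N.
Proof.
elim: d => [|d IH]; first by rewrite subnn muln0.
have [Md|dM] := ltnP M d.
  rewrite ffact_small ?subn0; last exact: leq_trans Md _.
  rewrite leq_mul2r; apply/orP; right; apply: leq_trans (ltnW Md) _.
  by rewrite (leq_trans (leqnSn d)) // -{1}(muln1 d.+1) leq_mul2l.
have : (M ^_ d <= M ^ d)%N.
  by elim: d {IH dM} => // d IH; rewrite ffactnSr expnSr leq_mul ?leq_subr.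
rewrite ffactnSr expnSr; move: (M ^ d)%N (M ^_ d)%N IH => a b IH ba.
have -> : (a * M - b * (M - d) = M * (a - b) + b * d)%N by nia.
have : (M * (M * (a - b)) <= M * (d ^ 2 * a))%N by rewrite leq_mul2l IH orbT.
have : (M * (b * d) <= M * (a * d))%N by rewrite !(leq_mul2l, leq_mul2r) ba !orbT.
have -> : (d.+1 ^ 2 * (a * M) = M * (d ^ 2 * a) + M * (a * d) + M * (a * d) + M * a)%N by ring.
lia.
Qed.

(** Up to the factor [M ^_ d], the coefficient of the word [w] is [psi w]. Counting all readings
    instead gives [F] at the letter counts of [w], which by homogeneity is at least [M ^ d * c]; the
    error is at most [A * (M ^ d - M ^_ d)]. *)
Lemma polya (R : realType) (T : finType) d (F : (T -> R) -> R) (c : R) :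
  0 < c -> form d F ->
  (forall z, (forall t, 0 <= z t) -> \sum_t z t = 1 -> c <= F z) ->
  exists (N M : nat) (phi : {ffun 'I_M -> T} -> R),
    (forall w, 0 <= phi w) /\
    forall z, (\sum_t z t) ^+ N * F z = \sum_w phi w * \prod_i z (w i).
Proof.
move=> c0 formF; have Fhom := form_homog formF; case: formF => L FL Fc.
pose A := \sum_(cs <- L) `|cs.1|.
have A0 : 0 <= A by apply: sumr_ge0.
(* Large enough that the error, at most [A * d ^ 2 * M ^ d / M], does not exceed [M ^ d * c], and
   that [M ^_ d] is nonzero. *)
pose M := (Num.trunc (A * (d ^ 2)%:R / c) + d).+1.
have Mbound : A * (d ^ 2)%:R <= M%:R * c.
  rewrite -ler_pdivrMr //; apply: ltW; apply: lt_le_trans (truncnS_gt _) _.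
  by rewrite ler_nat ltnS leq_addr.
have dM : (d <= M)%N by rewrite leqW // leq_addl.
have M0 : (0 < M)%N by [].
have ff0 : (0 < M ^_ d)%N by rewrite ffact_gt0.
pose psi (w : {ffun 'I_M -> T}) := \sum_(cs <- L) cs.1 * #|inj_readings cs.2 w|%:R.
exists (M - d)%N, M, (fun w => psi w / (M ^_ d)%:R); split => [w|z]; last first.
  under [RHS]eq_bigr => w _ do rewrite /psi !mulr_suml.
  rewrite exchange_big /= FL mulr_sumr; apply: eq_bigr => cs _.
  rewrite (eq_bigr (fun w => cs.1 / (M ^_ d)%:R *
    (#|inj_readings cs.2 w|%:R * \prod_i z (w i)))) => [|w _]; last by ring.
  rewrite -mulr_sumr sum_inj_readings; field.
  by rewrite pnatr_eq0 -lt0n.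
rewrite divr_ge0 //.
pose cnt t : R := #|[set i | w i == t]|%:R.
have cnt1 : \sum_t M%:R^-1 * cnt t = 1.
  rewrite -mulr_sumr -natr_sum.
  have <- : M = (\sum_t #|[set i | w i == t]|)%N; last by rewrite mulVf ?pnatr_eq0.
  rewrite -[LHS]card_ord -sum1_card.
  rewrite (partition_big w xpredT) //=; apply: eq_bigr => t _.
  by rewrite cardsE -sum1_card.
have Fcnt : F cnt = \sum_(cs <- L) cs.1 * #|readings cs.2 w|%:R.
  by rewrite FL; apply: eq_bigr => cs _; rewrite card_readings natr_prod.
have Fcnt_ge : M%:R ^+ d * c <= F cnt.
  have -> : F cnt = M%:R ^+ d * F (fun t => M%:R^-1 * cnt t).
    by rewrite Fhom exprVn mulVKf // expf_neq0 // pnatr_eq0.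
  by rewrite ler_wpM2l ?exprn_ge0 // Fc // => t; rewrite mulr_ge0 ?invr_ge0.
have Fpsi : F cnt - psi w <= A * (M ^ d - M ^_ d)%:R.
  rewrite Fcnt /psi -sumrB mulr_suml; apply: ler_sum => cs _; rewrite -mulrBr.
  have le_inj : (#|inj_readings cs.2 w| <= #|readings cs.2 w|)%N.
    by apply: subset_leq_card; apply/subsetP => f; rewrite inE => /andP[].
  rewrite -natrB //; apply: le_trans (ler_norm _) _; rewrite normrM normr_nat.
  by rewrite ler_wpM2l // ler_nat leq_subLR card_readings_inj.
have := ffact_asymp d M; rewrite -(ler_nat R) !natrM !natrX => le_defect.
have : M%:R * (A * (M ^ d - M ^_ d)%:R) <= M%:R * (M%:R ^+ d * c).
  rewrite mulrCA; apply: le_trans (ler_wpM2l A0 le_defect) _.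
  by rewrite mulrA mulrC [leRHS]mulrCA ler_wpM2l ?exprn_ge0 // -natrM.
rewrite ler_pM2l ?ltr0n //; lra.
Qed.

Import SphereCompactness.

(** * Polya's theorem on the zero locus of a nonnegative form *)

Section FormPenalty.
Variables (R : realType) (T : finType).
Implicit Types (z : T -> R) (F G : (T -> R) -> R).

Lemma form_eq_arg d F z z' : form d F -> z =1 z' -> F z = F z'.
Proof.
move=> [L FL] zz'; rewrite !FL; apply: eq_bigr => cs _.
by congr (_ * _); apply: eq_bigr.
Qed.

Lemma cts_form d F : form d F ->
  cts (fun y : 'rV[R]_#|T| => F (fun t => y 0 (enum_rank t) ^+ 2)).
Proof.
move=> [L FL]; have := @cts_sum R #|T| _ L
  (fun cs y => cs.1 * \prod_(t <- cs.2) y 0 (enum_rank t) ^+ 2).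
move=> /(_ _)/cts_ext; apply; last by move=> y; rewrite FL.
move=> cs; apply: ctsM; first exact: cts_cst.
apply: (@cts_prod _ _ _ _ (fun t y => y 0 (enum_rank t) ^+ 2)) => t.
exact/ctsX/cts_coord.
Qed.

(* The simplex is parametrized by the sphere through [z t = y t ^+ 2]. *)
Lemma form_penalty d e F G : form d F -> form e G -> (forall z, 0 <= G z) ->
  (forall z, (forall t, 0 <= z t) -> \sum_t z t = 1 -> G z = 0 -> 0 < F z) ->
  exists C c : R, 0 < c /\
    forall z, (forall t, 0 <= z t) -> \sum_t z t = 1 -> c <= F z + C * G z.
Proof.
move=> hF hG G0 FG.
have sumE (y : 'rV[R]_#|T|) : \sum_t y 0 (enum_rank t) ^+ 2 = \sum_i y 0 i ^+ 2.
  rewrite [RHS](reindex (@enum_rank T)) //.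
  by apply: onW_bij; apply: enum_rank_bij.
have [|y yS Gy|C [c [_ c0 cFG]]] := sphere_penalty (cts_form hF) (cts_form hG).
- by move=> y; apply: G0.
- by apply: FG => // [t|]; rewrite ?sqr_ge0 ?sumE.
exists C, c; split => // z z0 z1.
pose y : 'rV[R]_#|T| := \row_i Num.sqrt (z (enum_val i)).
have yE t : y 0 (enum_rank t) ^+ 2 = z t by rewrite mxE enum_rankK sqr_sqrtr.
have := cFG y; rewrite -sumE (eq_bigr _ (fun t _ => yE t)) => /(_ z1).
by rewrite (form_eq_arg hF yE) (form_eq_arg hG yE).
Qed.

(** Polya's theorem is applied to [F + C * G], both terms being raised to degree [d + e] by powers
    of [\sum_t z t], which is 1 on the simplex. Where [G] vanishes, only the multiple of [F]
    remains. *)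
Lemma polya_zero_locus d e F G : form d F -> form e G -> (forall z, 0 <= G z) ->
  (forall z, (forall t, 0 <= z t) -> \sum_t z t = 1 -> G z = 0 -> 0 < F z) ->
  exists (N M : nat) (phi : {ffun 'I_M -> T} -> R),
    (forall w, 0 <= phi w) /\
    forall z, G z = 0 ->
      (\sum_t z t) ^+ N * F z = \sum_w phi w * \prod_i z (w i).
Proof.
move=> hF hG G0 FG; have [C [c [c0 cFG]]] := form_penalty hF hG G0 FG.
have hS : form 1 (fun z => \sum_t z t) by apply: form_sum => t; apply: form_coord.
have hH : form (d + e)
    (fun z => F z * (\sum_t z t) ^+ e + C * (G z * (\sum_t z t) ^+ d)).
  apply: formD; first by have := formM hF (formX e hS); rewrite mul1n.
  by apply: formZ; have := formM hG (formX d hS); rewrite mul1n addnC.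
have [z z0 z1|N [M [phi [phi0 phiE]]]] := polya c0 hH.
  by rewrite z1 !expr1n !mulr1 cFG.
exists (N + e)%N, M, phi; split => // z Gz.
by rewrite -phiE Gz mul0r mulr0 addr0 exprD -mulrA (mulrC (F z)).
Qed.
End FormPenalty.

From mathcomp Require Import mpoly.

(** * Positive forms become sums of squares after multiplication by a power of the squared norm *)

Section Veronese.
Variables (R : realType) (n : nat).

Notation T := ('I_n.+1 * 'I_n.+1 * bool)%type.
Implicit Types (x : 'rV[R]_n.+1) (z : T -> R).

(* A square version of the Veronese map: the normalization makes the sum of all
   coordinates equal to [\sum_i x_i ^+ 2], and [polar] recovers [x_i * x_j]. *)
Definition pair_squares x (t : T) : R :=
  (x 0 t.1.1 + (-1) ^+ t.2 * x 0 t.1.2) ^+ 2 / (4 * n.+1)%:R.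

Definition polar z (i j : 'I_n.+1) : R :=
  n.+1%:R * (z (i, j, false) - z (i, j, true)).

Let n1_neq0 : n.+1%:R != 0 :> R. Proof. by rewrite pnatr_eq0. Qed.

Lemma sum_pair_squares x : \sum_t pair_squares x t = \sum_i x 0 i ^+ 2.
Proof.
rewrite -mulr_suml.
pose sq (ij : 'I_n.+1 * 'I_n.+1) (b : bool) :=
  (x 0 ij.1 + (-1) ^+ b * x 0 ij.2) ^+ 2.
rewrite (eq_bigr (fun t : T => sq t.1 t.2)); last by case.
rewrite -(pair_big xpredT xpredT sq) /= /sq.
rewrite (eq_bigr (fun ij => 2 * (x 0 ij.1 ^+ 2 + x 0 ij.2 ^+ 2))) => [|ij _];
  last by rewrite big_bool /=; ring.
rewrite -mulr_sumr -(pair_big xpredT xpredT (fun i j => x 0 i ^+ 2 + x 0 j ^+ 2)) /=.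
under eq_bigr => i _ do rewrite big_split /= sumr_const card_ord.
rewrite big_split /= sumr_const card_ord sumrMnl -mulr2n.
rewrite -[_ *+ n.+1]mulr_natl -[_ *+ 2]mulr_natl; field.
by rewrite nat1r n1_neq0.
Qed.

Lemma polar_pair_squares x i j : polar (pair_squares x) i j = x 0 i * x 0 j.
Proof. by rewrite /polar /pair_squares /=; field; rewrite nat1r n1_neq0. Qed.

Lemma form_polar i j : form 1 (fun z => polar z i j).
Proof. by apply: formZ; apply: formB; apply: form_coord. Qed.

Lemma mnm_splitS k d (m : 'X_{1.. k}) : mdeg m = d.+1 ->
  exists i m', m = (m' + U_(i))%MM /\ mdeg m' = d.
Proof.
move=> md; have [i mi|m0] := pickP (fun i => m i != 0%N); last first.
  by move: md; rewrite mdegE big1 // => i _; apply/eqP/negPn; rewrite m0.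
have Em : m = (m - U_(i) + U_(i))%MM by rewrite submK // lep1mP.
exists i, (m - U_(i))%MM; split => //.
by move: md; rewrite {1}Em mdegD mdeg1 addn1 => -[].
Qed.

(** Variables are split off in pairs, and each product [x_i x_j] becomes the linear form
    [polar z i j], which halves the degree. *)
Lemma form_of_mnm d (m : 'X_{1.. n.+1}) : mdeg m = d.*2 ->
  exists G, form d G /\ forall z x,
    (forall i j, polar z i j = x 0 i * x 0 j) -> G z = \prod_i x 0 i ^+ m i.
Proof.
elim: d m => [|d IH] m md.
  exists (fun=> 1); split; first exact: form1.
  move=> z x _; move/eqP: md; rewrite mdeg_eq0 => /eqP ->.
  by rewrite big1 // => i _; rewrite mnm0E.
have [i [m1 [-> m1d]]] := mnm_splitS md.
have [j [m2 [-> /IH [G [hG GE]]]]] := mnm_splitS m1d.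
exists (fun z => polar z i j * G z); split; first exact: formM (form_polar i j) hG.
move=> z x zx; rewrite (GE _ _ zx) zx.
have XU k : x 0 k = \prod_l x 0 l ^+ U_(k)%MM l.
  rewrite (bigD1 k) //= mnm1E eqxx expr1 big1 ?mulr1 // => l lk.
  by rewrite mnm1E eq_sym (negPf lk) expr0.
rewrite (XU i) (XU j) -!big_split /=; apply: eq_bigr => l _.
by rewrite !mnmDE !exprD; ring.
Qed.

(** The condition on [z] involves only [polar z], so that it covers every simplex zero of
    [rank_one_defect], not just the points [pair_squares x]. *)
Lemma form_of_mpoly d (F : {mpoly R[n.+1]}) : F \is d.*2.-homog ->
  exists G, form d G /\ forall z x,
    (forall i j, polar z i j = x 0 i * x 0 j) -> G z = F.@[x 0].
Proof.
move/dhomogP => Fh.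
suff [G [hG GE]] : exists G, form d G /\ forall z x,
    (forall i j, polar z i j = x 0 i * x 0 j) ->
    G z = \sum_(m <- msupp F) F@_m * \prod_i x 0 i ^+ m i.
  by exists G; split=> // z x /GE ->; rewrite mevalE.
elim: (msupp F) Fh => [|m r IH] Fh.
  by exists (fun=> 0); split=> [|z x _]; [exact: form0|rewrite big_nil].
have [|G [hG GE]] := IH; first by move=> k kr; apply: Fh; rewrite inE kr orbT.
have [K [hK KE]] := form_of_mnm (Fh m (mem_head _ _)).
exists (fun z => F@_m * K z + G z); split; first exact: formD (formZ _ hK) hG.
by move=> z x zx; rewrite big_cons (KE _ _ zx) (GE _ _ zx).
Qed.

(* Sum of squares of those equations of the image of [pair_squares] that force
   [polar z] to be [x^T x]: on the simplex the trace of [polar z] is 1, so some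
   diagonal entry is positive, and the minors through it suffice. *)
Definition rank_one_defect z : R :=
  \sum_i \sum_j \sum_k
    (polar z i j * polar z k k - polar z i k * polar z j k) ^+ 2 +
  (\sum_i polar z i i - \sum_t z t) ^+ 2 * (\sum_t z t) ^+ 2.

(** The factor [(\sum_t z t) ^+ 2] brings the trace equation to the degree of the squared minors. *)
Lemma form_rank_one_defect : form 4 rank_one_defect.
Proof.
have hS : form 1 (fun z => \sum_t z t) by apply: form_sum => t; apply: form_coord.
have htr : form 1 (fun z => \sum_i polar z i i).
  by apply: form_sum => i; apply: form_polar.
apply: formD; last exact: (formM (formX 2 (formB htr hS)) (formX 2 hS)).
do 3 (apply: form_sum => ?).
exact: (formX 2 (formB (formM (form_polar _ _) (form_polar _ _))
  (formM (form_polar _ _) (form_polar _ _)))).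
Qed.

Lemma rank_one_defect_ge0 z : 0 <= rank_one_defect z.
Proof.
apply: addr_ge0; last by rewrite mulr_ge0 ?sqr_ge0.
by do 3 (apply: sumr_ge0 => ? _); apply: sqr_ge0.
Qed.

Lemma rank_one_defect_pair_squares x : rank_one_defect (pair_squares x) = 0.
Proof.
rewrite /rank_one_defect sum_pair_squares.
rewrite [X in _ + X](_ : _ = 0) ?addr0; last first.
  under eq_bigr => i _ do rewrite polar_pair_squares -expr2.
  by rewrite subrr expr0n mul0r.
do 3 (apply: big1 => ? _); rewrite !polar_pair_squares; ring.
Qed.

Lemma rank_one_defect_eq0 z : \sum_t z t = 1 -> rank_one_defect z = 0 ->
  exists x, \sum_i x 0 i ^+ 2 = 1 /\ forall i j, polar z i j = x 0 i * x 0 j.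
Proof.
move=> z1 /eqP; rewrite paddr_eq0; last 2 first.
- by do 3 (apply: sumr_ge0 => ? _); apply: sqr_ge0.
- by rewrite mulr_ge0 ?sqr_ge0.
rewrite z1 expr1n mulr1 sqrf_eq0 subr_eq0 => /andP[/eqP minors /eqP tr1].
have minor i j k : polar z i j * polar z k k = polar z i k * polar z j k.
  apply/eqP; rewrite -subr_eq0 -sqrf_eq0; apply/eqP.
  have mi := psumr_eq0P (fun i _ => sumr_ge0 _ (fun j _ => sumr_ge0 _ (fun k _ =>
    sqr_ge0 _))) minors (i := i) isT.
  have mj := psumr_eq0P (fun j _ => sumr_ge0 _ (fun k _ => sqr_ge0 _)) mi (i := j) isT.
  exact: (psumr_eq0P (fun k _ => sqr_ge0 _) mj (i := k) isT).
have [k zk] : exists k, 0 < polar z k k.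
  apply/existsP; apply: contraPT tr1 => /existsPn zk.
  apply/eqP; rewrite lt_eqF // (le_lt_trans _ ltr01) //.
  by apply: sumr_le0 => i _; rewrite leNgt zk.
(* Column [k] of a rank-one matrix [x^T x] is [x_k x], and its diagonal entry is [x_k ^ 2]. *)
pose x : 'rV[R]_n.+1 := \row_i (polar z i k / Num.sqrt (polar z k k)).
have xE i j : polar z i j = x 0 i * x 0 j.
  rewrite !mxE mulf_div -minor -expr2 sqr_sqrtr ?mulfK ?gt_eqF ?ltW //.
exists x; split => //; rewrite -tr1; apply: eq_bigr => i _.
by rewrite xE expr2.
Qed.

Lemma positive_form_sos d (F : {mpoly R[n.+1]}) : F \is d.*2.-homog ->
  (forall x, \sum_i x 0 i ^+ 2 = 1 -> 0 < F.@[x 0]) ->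
  exists (N : nat) (s : seq {mpoly R[n.+1]}), forall x,
    (\sum_i x 0 i ^+ 2) ^+ N * F.@[x 0] = \sum_(q <- s) q.@[x 0] ^+ 2.
Proof.
move=> Fh F0; have [G [hG GE]] := form_of_mpoly Fh.
have [z z0 z1 Gz|N [M [phi [phi0 phiE]]]] :=
    polya_zero_locus hG form_rank_one_defect rank_one_defect_ge0.
  have [x [x1 zx]] := rank_one_defect_eq0 z1 Gz.
  by rewrite (GE _ _ zx) F0.
(* The coordinates of [pair_squares] are squares of the linear forms [ell t], so each monomial in
   them with a nonnegative coefficient is the square of a polynomial. *)
pose ell (t : T) : {mpoly R[n.+1]} :=
  (Num.sqrt (4 * n.+1)%:R)^-1 *: ('X_t.1.1 + (-1) ^+ t.2 *: 'X_t.1.2).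
have ellE t x : (ell t).@[x 0] ^+ 2 = pair_squares x t.
  rewrite mevalZ mevalD mevalZ !mevalXU exprMn mulrC exprVn sqr_sqrtr //.
exists N, [seq Num.sqrt (phi w) *: \prod_i ell (w i) | w <- enum {ffun 'I_M -> T}].
move=> x; rewrite -(GE _ _ (polar_pair_squares x)) -sum_pair_squares phiE; last first.
  exact: rank_one_defect_pair_squares.
rewrite big_map big_enum /=; apply: eq_bigr => w _.
rewrite mevalZ exprMn sqr_sqrtr // rmorph_prod -prodrXl.
by congr (_ * _); apply: eq_bigr => i _; rewrite ellE.
Qed.
End Veronese.

(** * Absorbing the constraints into one function positive on the sphere *)

Section Separation.
Variable R : realType.

Lemma mul_expr_onem_le (y : R) k : 0 <= y <= 1 -> y * (1 - y) ^+ k <= k.+1%:R^-1.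
Proof.
move=> /andP[y0 y1]; have x0 : 0 <= 1 - y by rewrite subr_ge0.
rewrite -[leRHS]mul1r ler_pdivlMr ?ltr0n //.
(* The two terms are the probabilities of one and of no success in [k + 1] trials with success
   probability [y]; the stronger bound carries the induction. *)
suff : y * (1 - y) ^+ k * k.+1%:R + (1 - y) ^+ k.+1 <= 1.
  by have := exprn_ge0 k.+1 x0; lra.
elim: k => [|k IH]; first by lra.
have xk : (1 - y) ^+ k.+1 <= 1 by rewrite exprn_ile1 // lerBlDr lerDl.
have := ler_wpM2l y0 xk; have := ler_wpM2l x0 IH.
by rewrite -[k.+2%:R]natr1 !exprS; lra.
Qed.

(** For [y >= 0] the correction vanishes and the previous bound applies; for [y < 0] the power is at
    least 1, and the correction term is exactly [y]. *)
Lemma penalty_term_le (y : R) e : y <= 1 ->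
  (1 - y) ^+ (2 * e) * y <= (2 * e).+1%:R^-1 - (`|y| - y) / 2.
Proof.
move=> y1; have [y0|y0] := lerP 0 y.
  by rewrite ger0_norm // subrr mul0r subr0 mulrC mul_expr_onem_le ?y0.
rewrite ltr0_norm //.
have : (1 - y) ^+ (2 * e) * y <= 1 * y by rewrite ler_nM2r // exprn_ege1 //; lra.
have : 0 <= (2 * e).+1%:R^-1 :> R by rewrite invr_ge0.
move: ((1 - y) ^+ _ * y) (_^-1) => a b. lra.
Qed.

Lemma sphere_separation k m (P : 'rV[R]_k -> R) (Q : 'I_m -> 'rV[R]_k -> R) :
  cts P -> (forall i, cts (Q i)) ->
  (forall x : 'rV[R]_k, \sum_i x 0 i ^+ 2 = 1 -> (forall i, 0 <= Q i x) -> 0 < P x) ->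
  exists (B c : R) (e : nat), 0 <= c /\
    forall x : 'rV[R]_k, \sum_i x 0 i ^+ 2 = 1 ->
      0 < P x - c * \sum_i (B - Q i x) ^+ (2 * e) * Q i x.
Proof.
move=> cP cQ PQ.
have [||x xS Q0|C [a [C0 a0 PC]]] :=
    @sphere_penalty _ _ P (fun x => \sum_i (`|Q i x| - Q i x)) cP.
- apply: (@cts_sum _ _ _ _ (fun i x => `|Q i x| - Q i x)) => i.
  by apply: ctsD; [apply: cts_norm|apply: ctsN].
- by move=> x; apply: sumr_ge0 => i _; rewrite subr_ge0 ler_norm.
- apply: PQ => // i; apply/normr_idP/eqP; rewrite -subr_eq0; apply/eqP.
  have Qi j : true -> 0 <= `|Q j x| - Q j x by rewrite subr_ge0 ler_norm.
  exact: (psumr_eq0P Qi Q0).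
(* With the constant penalty 1, whose zero set is empty, the penalty lemma merely bounds
   [\sum_i |Q i x|] by [B] on the sphere. *)
have [|||x xS /eqP|B [b [B0 b0 QB]]] :=
    @sphere_penalty _ k (fun x => - \sum_i `|Q i x|) (fun=> 1).
- by apply: ctsN; apply: (@cts_sum _ _ _ _ (fun i x => `|Q i x|)) => i; apply: cts_norm.
- exact: cts_cst.
- by move=> x; exact: ler01.
- by rewrite oner_eq0.
(* Makes the total error [2 * C * (B + 1) * m / (2 * e + 1)] smaller than the margin [a]. *)
pose e := Num.trunc (2 * C * (B + 1) * m%:R / a).
(* With [Q i x = (B + 1) * y], the factor [c] turns each term into [2 * C * (B + 1)] times
   [(1 - y) ^ (2 e) * y]. Using [B + 1] keeps the scale positive even if [B = 0]. *)
exists (B + 1), (2 * C / (B + 1) ^+ (2 * e)), e; split.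
  by rewrite divr_ge0 ?mulr_ge0 // exprn_ge0 // addr_ge0.
move=> x xS; have B1 : 0 < B + 1 by rewrite ltr_wpDl.
have small : 2 * C * (B + 1) * (m%:R / (2 * e).+1%:R) < a.
  rewrite mulrA ltr_pdivrMr ?ltr0n // -ltr_pdivrMl // mulrC.
  apply: lt_le_trans (truncnS_gt _) _; rewrite ler_nat ltnS -/e.
  by rewrite mul2n -addnn leq_addr.
apply: lt_le_trans (_ : a - 2 * C * (B + 1) * (m%:R / (2 * e).+1%:R) <= _).
  by rewrite subr_gt0.
have := PC x xS.
suff : 2 * C / (B + 1) ^+ (2 * e) * \sum_i (B + 1 - Q i x) ^+ (2 * e) * Q i x <=
   2 * C * (B + 1) * (m%:R / (2 * e).+1%:R) - C * \sum_i (`|Q i x| - Q i x).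
  move: (_ / _ * _) (C * \sum_i _) (_ * (_ / _)) => u v w; lra.
have -> : m%:R = \sum_(i < m) (1 : R) by rewrite sumr_const card_ord.
rewrite mulr_suml !mulr_sumr -sumrB.
apply: ler_sum => i _.
have QiB : Q i x <= B + 1.
  have := QB x xS; have := ler_norm (Q i x).
  have : `|Q i x| <= \sum_j `|Q j x|.
    by rewrite (bigD1 i) //= lerDl sumr_ge0.
  lra.
have [y Qy] : exists y, Q i x = (B + 1) * y.
  by exists (Q i x / (B + 1)); rewrite mulrC divfK ?gt_eqF.
have y1 : y <= 1 by rewrite -(ler_pM2l B1) -Qy mulr1.
have CB : 0 <= 2 * C * (B + 1) by rewrite !mulr_ge0 // ltW.
have := ler_wpM2l CB (penalty_term_le e y1).
have -> : B + 1 - Q i x = (B + 1) * (1 - y) by rewrite Qy; ring.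
rewrite Qy normrM (gtr0_norm B1) exprMn.
move=> le_y; apply: le_trans (le_trans le_y _); last first.
  by rewrite le_eqVlt; apply/orP; left; apply/eqP; field; rewrite -natrM nat1r pnatr_eq0.
by rewrite le_eqVlt; apply/orP; left; apply/eqP; field; rewrite expf_neq0 // gt_eqF.
Qed.
End Separation.

(** * Closure properties of sums of squares *)

Section SumsOfSquares.
Variables (R : realType) (n : nat).
Implicit Types f g : {mpoly R[n]}.

Definition sos f := exists s : seq {mpoly R[n]}, f = \sum_(q <- s) q ^+ 2.

Lemma sos_sqr f : sos (f ^+ 2).
Proof. by exists [:: f]; rewrite big_seq1. Qed.

Lemma sos0 : sos 0.
Proof. by exists [::]; rewrite big_nil. Qed.

Lemma sosD f g : sos f -> sos g -> sos (f + g).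
Proof. by move=> [s ->] [r ->]; exists (s ++ r); rewrite big_cat. Qed.

Lemma sos_sum (I : Type) (r : seq I) (F : I -> {mpoly R[n]}) :
  (forall i, sos (F i)) -> sos (\sum_(i <- r) F i).
Proof. by move=> hF; apply: big_ind => //; [exact: sos0|exact: sosD]. Qed.

Lemma sosM f g : sos f -> sos g -> sos (f * g).
Proof.
move=> [s ->] [r ->]; rewrite mulr_suml; apply: sos_sum => a.
rewrite mulr_sumr; apply: sos_sum => b; rewrite -exprMn; exact: sos_sqr.
Qed.

Lemma sosX f k : sos f -> sos (f ^+ k).
Proof.
move=> hf; elim: k => [|k IH]; last by rewrite exprS; apply: sosM.
by rewrite expr0 -(expr1n _ 2); apply: sos_sqr.
Qed.

Lemma sosZ (c : R) f : 0 <= c -> sos f -> sos (c *: f).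
Proof.
move=> c0 [s ->]; rewrite scaler_sumr; apply: sos_sum => q.
by rewrite -(sqr_sqrtr c0) -exprZn; apply: sos_sqr.
Qed.

(** Padding with zeros lets lists of different lengths share one index set. *)
Lemma sum_nth_pad (V : nmodType) (h : {mpoly R[n]} -> V) s K :
  h 0 = 0 -> (size s <= K)%N -> \sum_(q <- s) h q = \sum_(l < K) h (nth 0 s l).
Proof.
move=> h0 sK; rewrite (big_nth 0) -(big_mkord xpredT (fun l => h (nth 0 s l))).
rewrite (big_cat_nat (leq0n _) sK) /= [X in _ + X]big1_seq ?addr0 // => l.
by rewrite mem_index_iota => /andP[_ /andP[sl _]]; rewrite nth_default.
Qed.
End SumsOfSquares.

(** * Powers of the squared norm, and evaluation at the point [(1, t)] *)

Section Homogenization.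
Variables (R : realType) (n : nat).
Implicit Types (F : {mpoly R[n.+1]}) (t : 'rV[R]_n).

Lemma cts_meval k (F : {mpoly R[k]}) : cts (fun x : 'rV[R]_k => F.@[x 0]).
Proof.
have := @cts_sum R k _ (msupp F) (fun m x => F@_m * \prod_i x 0 i ^+ m i).
move=> /(_ _)/cts_ext; apply; last by move=> x; rewrite mevalE.
move=> m; apply: ctsM; first exact: cts_cst.
apply: (@cts_prod _ _ _ _ (fun i (x : 'rV[R]_k) => x 0 i ^+ m i)) => i.
exact/ctsX/cts_coord.
Qed.

Definition nrm k : {mpoly R[k]} := \sum_(i < k) 'X_i ^+ 2.

Lemma nrmE k (x : 'I_k -> R) : (nrm k).@[x] = \sum_i x i ^+ 2.
Proof. by rewrite rmorph_sum; apply: eq_bigr => i _; rewrite rmorphXn /= mevalXU. Qed.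

Lemma nrmX_homog k e : nrm k ^+ e \is e.*2.-homog.
Proof.
rewrite -mul2n; apply: dhomogMn; apply: rpred_sum => i _.
by rewrite -[2%N]mul1n; apply: dhomogMn; rewrite dhomogX /= mdeg1.
Qed.

Definition affine_point t : 'rV[R]_n.+1 := \row_i oapp (t 0) 1 (unlift ord0 i).

Definition dehomog F : {mpoly R[n]} :=
  F \mPo [tuple oapp (fun j => 'X_j) 1 (unlift ord0 i) | i < n.+1].

Lemma dehomogE F t : (dehomog F).@[t 0] = F.@[affine_point t 0].
Proof.
rewrite comp_mpoly_meval; apply: meval_eq => i.
by rewrite tnth_mktuple mxE; case: unliftP => [j|] _ /=; rewrite ?mevalXU ?meval1.
Qed.

Lemma meval_affine_point (p : {mpoly R[n]}) P t :
  is_homogenization p P -> P.@[affine_point t 0] = p.@[t 0].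
Proof.
move=> [_ ->]; rewrite !mxE unlift_none ?oner_neq0 // expr1n mul1r.
by apply: meval_eq => i; rewrite mxE liftK divr1.
Qed.

Lemma sum_affine_point t : \sum_i affine_point t 0 i ^+ 2 = (theta t)^-1.
Proof.
rewrite invrK big_ord_recl mxE unlift_none expr1n; congr (_ + _).
by apply: eq_bigr => i _; rewrite mxE liftK.
Qed.

Lemma theta_inv_neq0 t : (theta t)^-1 != 0.
Proof.
by rewrite invrK gt_eqF // ltr_wpDr // sumr_ge0 // => i _; apply: sqr_ge0.
Qed.

Lemma affine_nrmE t : (1 + nrm n).@[t 0] = (theta t)^-1.
Proof. by rewrite invrK mevalD meval1 nrmE. Qed.

Lemma sos_affine_nrm : sos (1 + nrm n).
Proof.
apply: sosD; first by rewrite -(expr1n _ 2); apply: sos_sqr.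
by apply: sos_sum => i; apply: sos_sqr.
Qed.
End Homogenization.

Theorem theorem4p2 (R : realType) (n : nat) (hn : (1 <= n)%N)
  (m : nat) (p_ : 'I_m -> {mpoly R[n]}) (p : {mpoly R[n]})
  (pk_even : forall k, ~~ odd (mpoly_deg (p_ k)))
  (p_even : ~~ odd (mpoly_deg p))
  (P_ : 'I_m -> {mpoly R[n.+1]}) (P : {mpoly R[n.+1]})
  (Pk_homogenization : forall k, is_homogenization (p_ k) (P_ k))
  (P_homogenization : is_homogenization p P)
  (P_pos : forall x : 'rV[R]_n.+1,
     x != 0 -> (forall k, 0 <= (P_ k).@[x 0]) -> 0 < P.@[x 0]) :
  exists (b : nat) (L : finType)
    (q : L -> {mpoly R[n]}) (q_ : 'I_m -> L -> {mpoly R[n]}),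
  forall t : 'rV[R]_n,
    p.@[t 0] =
    theta t ^+ (2 * b) *
      (\sum_(l : L) (q l).@[t 0] ^+ 2 +
       \sum_(k < m) \sum_(l : L) (p_ k).@[t 0] * (q_ k l).@[t 0] ^+ 2).
Proof.
suff [b [f [g [sos_f sos_g fgE]]]] : exists (b : nat) (f : {mpoly R[n]})
    (g : 'I_m -> {mpoly R[n]}), [/\ sos f, forall k, sos (g k) &
    forall t : 'rV[R]_n, p.@[t 0] = theta t ^+ (2 * b) *
      (f.@[t 0] + \sum_(k < m) (p_ k).@[t 0] * (g k).@[t 0])].
  have [s_ gE] := fin_all_exists sos_g; have [s fE] := sos_f.
  pose K := (size s + \sum_k size (s_ k))%N.
  exists b, 'I_K, (fun l : 'I_K => nth 0 s l), (fun k (l : 'I_K) => nth 0 (s_ k) l).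
  move=> t; rewrite fgE; congr (_ * (_ + _)).
    rewrite fE rmorph_sum /=; under eq_bigr do rewrite rmorphXn.
    by apply: sum_nth_pad; rewrite ?leq_addr //= meval0 expr0n.
  apply: eq_bigr => k _; rewrite -mulr_sumr gE; congr (_ * _).
  rewrite rmorph_sum /=; under eq_bigr do rewrite rmorphXn.
  apply: sum_nth_pad; first by rewrite /= meval0 expr0n.
  by rewrite /K (bigD1 k) //= addnCA leq_addr.
pose d := (mpoly_deg p)./2; pose d_ k := (mpoly_deg (p_ k))./2.
have P_homog : P \is d.*2.-homog by rewrite even_halfK //; case: P_homogenization.
have Pk_homog k : P_ k \is (d_ k).*2.-homog.
  by rewrite even_halfK //; case: (Pk_homogenization k).
have [x xS Pk0|B [c [e [c0 sep]]]] :=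
    sphere_separation (@cts_meval _ _ P) (fun k => @cts_meval _ _ (P_ k)).
  apply: P_pos => //; apply: contra_eq_neq xS => ->.
  by rewrite big1 ?(eq_sym 0) ?oner_neq0 // => i _; rewrite mxE expr0n.
(* [r_ k] is half the degree of the [k]-th separating term, and [D] is a common bound for all
   half-degrees. *)
pose r_ k := (d_ k * (2 * e).+1)%N; pose D := (d + \sum_k r_ k)%N.
have rD k : (r_ k <= D)%N by rewrite /D (bigD1 k) //= addnCA leq_addr.
pose N := nrm R n.+1.
(* The separating function made homogeneous of degree [2 D]; on the sphere [N] is 1 and nothing
   changes. *)
pose F := N ^+ (D - d) * P -
  c *: \sum_k (B *: N ^+ d_ k - P_ k) ^+ (2 * e) * P_ k * N ^+ (D - r_ k).
have F_homog : F \is D.*2.-homog.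
  apply: rpredB.
    have -> : D.*2 = ((D - d).*2 + d.*2)%N by rewrite -doubleD subnK // leq_addr.
    by apply: dhomogM => //; apply: nrmX_homog.
  apply: rpredZ; apply: rpred_sum => k _.
  have -> : D.*2 = ((d_ k).*2 * (2 * e) + (d_ k).*2 + (D - r_ k).*2)%N.
    by have := rD k; rewrite /r_; nia.
  apply: dhomogM; last exact: nrmX_homog.
  apply: dhomogM => //; apply: dhomogMn; apply: rpredB => //.
  by apply: rpredZ; apply: nrmX_homog.
have FE x : F.@[x] = (\sum_i x i ^+ 2) ^+ (D - d) * P.@[x] -
    c * \sum_k (B * (\sum_i x i ^+ 2) ^+ d_ k - (P_ k).@[x]) ^+ (2 * e) *
      (P_ k).@[x] * (\sum_i x i ^+ 2) ^+ (D - r_ k).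
  rewrite mevalB mevalM mevalZ rmorph_sum rmorphXn /= nrmE; congr (_ - _ * _).
  apply: eq_bigr => k _.
  by rewrite !mevalM !rmorphXn /= mevalB mevalZ rmorphXn /= nrmE.
have F_pos (x : 'rV[R]_n.+1) : \sum_i x 0 i ^+ 2 = 1 -> 0 < F.@[x 0].
  move=> xS; rewrite FE xS !expr1n mul1r.
  under eq_bigr do rewrite !expr1n !mulr1.
  exact: sep.
have [M [s FsE]] := positive_form_sos F_homog F_pos.
(* At [(1, t)] the norm form takes the value [u = theta(t)^-1] of [U], and the identity isolates
   [u ^ b * p(t)]. Multiplying once more by [u ^ b] gives the even exponent; the multipliers remain
   sums of squares because [U] is one. *)
pose U := 1 + nrm R n; pose b := (M + (D - d))%N.
exists b, (U ^+ b * \sum_(q <- s) dehomog q ^+ 2),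
  (fun k => c *: (((B *: U ^+ d_ k - p_ k) ^+ e) ^+ 2 * U ^+ (M + (D - r_ k) + b))).
split=> [|k|t].
- apply: sosM; first exact/sosX/sos_affine_nrm.
  by apply: sos_sum => q; apply: sos_sqr.
- by apply: sosZ => //; apply: sosM; [exact: sos_sqr|exact/sosX/sos_affine_nrm].
have sE := FsE (affine_point t).
rewrite FE sum_affine_point (meval_affine_point _ P_homogenization) in sE.
have u0 := theta_inv_neq0 t.
rewrite -[theta t]invrK exprVn; set u := (theta t)^-1 in u0 sE *.
apply/esym/(canLR (mulKf (expf_neq0 _ u0))).
have UE k : (U ^+ k).@[t 0] = u ^+ k by rewrite rmorphXn /= affine_nrmE.
rewrite mevalM UE rmorph_sum /=.
under eq_bigr => q _ do rewrite rmorphXn /= dehomogE.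
rewrite -sE [(2 * b)%N]mul2n -addnn exprD.
have -> : \sum_k (p_ k).@[t 0] *
    (c *: (((B *: U ^+ d_ k - p_ k) ^+ e) ^+ 2 * U ^+ (M + (D - r_ k) + b))).@[t 0] =
  u ^+ b * u ^+ M * (c * \sum_k (B * u ^+ d_ k - (P_ k).@[affine_point t 0]) ^+ (2 * e) *
      (P_ k).@[affine_point t 0] * u ^+ (D - r_ k)).
  rewrite !mulr_sumr; apply: eq_bigr => k _.
  rewrite (meval_affine_point _ (Pk_homogenization k)) mevalZ mevalM UE !rmorphXn /=.
  rewrite mevalB mevalZ UE (mulnC 2) exprM (exprD u (M + _)) (exprD u M).
  move: (_ ^+ e ^+ 2) (u ^+ M) (u ^+ (D - _)) (u ^+ b) => v1 v2 v3 v4; ring.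
have -> : u ^+ b * u ^+ b = u ^+ b * u ^+ M * u ^+ (D - d) by rewrite -mulrA -(exprD u M).
move: (c * _) (u ^+ b) (u ^+ M) (u ^+ (D - d)) => v1 v2 v3 v4; ring.
Qed.
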